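(* Let $X$ be a Banach space. (a) If the norm of $X$ is rotund, then $(X, \text{weak})$ is fragmentable by a metric, i.e. there is a metric on $X$ that fragments $(X,\text{weak})$. (b) If the norm of $X$ is weakly locally uniformly rotund, then $(X, \text{weak})$ is fragmented by a metric which is stronger than the norm topology, i.e. by a metric on $X$ whose generated topology contains the norm topology.
   Context: $(X,\text{weak})$ denotes $X$ with its weak topology. Let $(Y,\tau)$ be a topological space and $\rho$ a metric on $Y$ (not assumed to be related to $\tau$). Given $\epsilon > 0$, $Y$ is fragmented by $\rho$ down to $\epsilon$ if each nonempty subset of $Y$ contains a nonempty $\tau$-relatively open subset (open relative to that subset) of $\rho$-diameter less than $\epsilon$. $Y$ is fragmented by $\rho$ if it is fragmented by $\rho$ down to $\epsilon$ for each $\epsilon > 0$. The norm $\|\cdot\|$ of a Banach space $X$ is rotund (strictly convex) if the unit sphere $\{x \in X : \|x\| = 1\}$ contains no nontrivial line segments. It is weakly locally uniformly rotund if, for every $x \in X$ and every sequence $(x_n)$ in $X$, $x_n - x \to 0$ weakly whenever $\lim_{n \to \infty} \|(x_n + x)/2\| = \lim_{n \to \infty} \|x_n\| = \|x\|$. *)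

(* Defs.v *)
From HB Require Import structures.
From mathcomp Require Import all_boot all_order all_algebra.
From mathcomp Require Import complex.
From mathcomp Require Import all_classical reals ereal topology normedtype sequences.

Set Implicit Arguments.
Unset Strict Implicit.
Unset Printing Implicit Defensive.

Import Order.TTheory GRing.Theory Num.Theory.
Import numFieldNormedType.Exports.

Local Open Scope classical_set_scope.
Local Open Scope ring_scope.

Definition dual (K : numFieldType) (X : normedModType K) : Type :=
  {f : {linear X -> K^o} | continuous f}.

Definition weak_topology_of (K : numFieldType) (X : normedModType K) : Type :=
  sup_topology (fun f : dual X =>
    Topological.class (initial_topology (sval f : X -> K^o))).

(* [weak X] is convertible to the carrier of [X]; only the canonical topology
   changes. *)
Definition weak (K : numFieldType) (X : normedModType K) : Type := X.

HB.instance Definition _ (K : numFieldType) (X : normedModType K) :=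
  Topological.copy (weak X) (weak_topology_of X).

Record is_metric (R : realType) (Y : Type) (rho : Y -> Y -> R) : Prop := {
  metric_refl : forall x, rho x x = 0 ;
  metric_eq : forall x y, rho x y = 0 -> x = y ;
  metric_sym : forall x y, rho x y = rho y x ;
  metric_triangle : forall x y z, rho x z <= rho x y + rho y z
}.

Definition metric_open (R : realType) (Y : Type) (rho : Y -> Y -> R)
    (U : set Y) : Prop :=
  forall x, U x -> exists2 r : R, 0 < r & [set y | rho x y < r] `<=` U.

Definition diam (R : realType) (Y : Type) (rho : Y -> Y -> R) (A : set Y) :
    \bar R :=
  ereal_sup [set (rho x y)%:E | x in A & y in A].

(* The relatively open subsets of [A] are the sets [A `&` U] with [U] open. *)
Definition fragmented_down_to (R : realType) (Y : topologicalType)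
    (rho : Y -> Y -> R) (eps : R) : Prop :=
  forall A : set Y, A !=set0 ->
    exists U : set Y,
      [/\ open U, A `&` U !=set0 & (diam rho (A `&` U) < eps%:E)%E].

Definition fragmented (R : realType) (Y : topologicalType)
    (rho : Y -> Y -> R) : Prop :=
  forall eps : R, 0 < eps -> fragmented_down_to rho eps.

Section norms.
Variables (K : numFieldType) (X : normedModType K).

(* For complex [K], [0 <= t <= 1] forces [t] to be real. *)
Definition segment (x y : X) : set X :=
  [set (1 - t) *: x + t *: y | t in [set t : K | 0 <= t <= 1]].

Definition rotund_norm : Prop :=
  forall x y : X, segment x y `<=` [set z | `|z| = 1] -> x = y.

Definition wLUR_norm : Prop :=
  forall (x : X) (u : nat -> X),
    `|2^-1 *: (u n + x)| @[n --> \oo] --> `|x| ->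
    `|u n| @[n --> \oo] --> `|x| ->
    (u n - x : weak X) @[n --> \oo] --> ((0 : X) : weak X).

End norms.

(* Main.v *)
From HB Require Import structures.
Require Import Defs.
From mathcomp Require Import all_boot all_order all_algebra complex.
From mathcomp Require Import all_classical reals ereal topology normedtype sequences.
From mathcomp Require Import ring lra.

Import Order.TTheory GRing.Theory Num.Theory.
Import numFieldNormedType.Exports.

Set Implicit Arguments.
Unset Strict Implicit.
Unset Printing Implicit Defensive.

Local Open Scope classical_set_scope.
Local Open Scope ring_scope.

(** The proof replaces metrics by countable families of colourings. Call a map f
on the space Y fragmenting if every nonempty subset of Y has a nonempty
relatively open piece on which f is constant. If the f_n are fragmenting and
together separate points, the metric sup {1/(n+1) : f_n y <> f_n z} fragments Y:
a set is cut successively for f_0, ..., f_(n-1), and what is left has diameter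
at most 1/(n+1). The fibres of each f_n are open for this metric.

Such maps come from a small-set principle ([fragmenting_of_small]): if every
nonempty set has a nonempty relatively open small piece, Zorn's lemma exhausts Y
by disjoint small pieces, taken off one after another, and the piece containing
a point is a fragmenting colour.

Rotund norms. Let A be nonempty, n a natural number. Balls are weakly closed, so
either A has a weakly open piece outside the ball of radius n, or A lies in that
ball. In the second case let s be the supremum of the norm on A; a functional u,
dominated by the norm and equal to it at a point of A whose norm is almost s,
cuts out the slice {u > s - 1/(n+1)} of A. Half-spaces are convex, hence the
midpoints of points of the slice, too, have norm above s - 1/(n+1)
([norm_slice_relatively_open]). Two points with equal colours for all n
therefore satisfy ||x|| = ||y|| = ||(x+y)/2||, and rotundity gives x = y.

Weakly locally uniformly rotund norms. Let a_n(x) be a chosen representative of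
the n-th fibre of x. The norms of a_n(x) and of (a_n(x)+x)/2 tend to ||x||, so
a_n(x) tends weakly to x. By Hahn-Banach, x is then a norm limit of rational
combinations z_q(x) = sum_i q_i a_i(x), and z_q(x) is determined by finitely
many colours of x. So the pair formed by these colours and the truth value of
||x - z_q(x)|| <= 1/(m+1) is again a fragmenting colour (closed balls are weakly
closed), there are countably many pairs (q, m), and points with the same colour,
with truth value true, are within 2/(m+1) of each other. The resulting
metric is stronger than the norm topology.

Both scalar fields are treated at once by restricting scalars to the reals: it
suffices that each real functional of norm at most one is weakly continuous,
which over the complex numbers holds because it is the real part of a
continuous complex functional. *)

(** * Fragmenting maps *)

Section fragmenting_maps.
Variable Y : topologicalType.

(** The partition into the fibres of such a map is an unordered form of a
relatively open partition indexed by an ordinal. *)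
Definition fragmenting (T : Type) (f : Y -> T) :=
  forall A : set Y, A !=set0 -> exists U : set Y,
    [/\ open U, A `&` U !=set0 &
        forall y z, (A `&` U) y -> (A `&` U) z -> f y = f z].

Lemma fragmenting_pair (T1 T2 : Type) (f : Y -> T1) (g : Y -> T2) :
  fragmenting f -> fragmenting g -> fragmenting (fun y => (f y, g y)).
Proof.
move=> Ff Fg A A0; have [U [oU AU0 fU]] := Ff A A0.
have [V [oV AUV0 gV]] := Fg _ AU0.
exists (U `&` V); split; first exact: openI.
  by rewrite setIA.
rewrite setIA => y z [AUy Vy] [AUz Vz].
by rewrite (fU y z) // (gV y z).
Qed.

Lemma fragmenting_mkseq (T : Type) (f : nat -> Y -> T) n :
  (forall k, fragmenting (f k)) -> fragmenting (fun y => mkseq (f^~ y) n).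
Proof.
move=> Ff; elim: n => [|n IH] A A0.
  by exists setT; split=> //; [exact: openT | rewrite setIT].
have [U [oU AU0 fU]] := fragmenting_pair IH (Ff n) A0.
exists U; split=> // y z AUy AUz.
by have [e1 e2] := fU y z AUy AUz; rewrite !mkseqS e1 e2.
Qed.

Lemma mkseq_eq_nth (T : Type) (a b : nat -> T) n i :
  (i < n)%N -> mkseq a n = mkseq b n -> a i = b i.
Proof.
by move=> lin /(congr1 (fun s => nth (a i) s i)); rewrite !nth_mkseq.
Qed.

(** Greedy exhaustion. Zorn's lemma orders the families F of disjoint small
sets, with open union, such that any set meeting the union has a relatively open
piece inside one member. If the union of a maximal family missed a point, a
small relatively open piece of its complement could be added. *)
Lemma fragmenting_of_small (P : set (set Y)) :
  (forall A : set Y, A !=set0 -> exists U : set Y,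
    [/\ open U, A `&` U !=set0 & P (A `&` U)]) ->
  exists f : Y -> set Y, fragmenting f /\ forall y, exists2 S, P S &
    forall z, f z = f y -> S z.
Proof.
move=> P_ex.
pose good (F : set (set Y)) := [/\ F `<=` P,
  forall S S' y, F S -> F S' -> S y -> S' y -> S = S',
  open (\bigcup_(S in F) S) &
  forall A, A `&` \bigcup_(S in F) S !=set0 -> exists U, exists2 S,
    F S & [/\ open U, A `&` U !=set0 & A `&` U `<=` S]].
have [G Ggood Gtot|F [[FP Fdisj Fopen Ffrag] Fmax]] :=
    @Zorn_bigcup (set Y) good.
  split.
  - by move=> S [F GF FS]; have [FP _ _ _] := Ggood _ GF; exact: FP.
  - move=> S S' y [F GF FS] [F' GF' FS'] Sy S'y.
    have [FF'|F'F] := Gtot _ _ GF GF'.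
      by have [_ dj _ _] := Ggood _ GF'; apply: (dj S S' y) => //; exact: FF'.
    by have [_ dj _ _] := Ggood _ GF; apply: (dj S S' y) => //; exact: F'F.
  - have -> : \bigcup_(S in \bigcup_(F in G) F) S =
        \bigcup_(F in G) \bigcup_(S in F) S.
      apply/seteqP; split=> [y [S [F GF FS] Sy]|y [F GF [S FS Sy]]].
        by exists F => //; exists S.
      by exists S => //; exists F.
    by apply: bigcup_open => F GF; have [_ _ ? _] := Ggood _ GF.
  - move=> A [y [Ay [S [F GF FS] Sy]]].
    have [_ _ _ fr] := Ggood _ GF.
    have [|U [S' FS' [oU AU0 AUS']]] := fr A.
      by exists y; split=> //; exists S.
    by exists U, S' => //; exists F.
have cover y : exists S, F S /\ S y.
  apply: contrapT => /forallNP nS.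
  have D0 : ~` (\bigcup_(S in F) S) !=set0.
    by exists y => -[S FS Sy]; apply: (nS S).
  have [U [oU DU0 PU]] := P_ex _ D0.
  pose W := ~` (\bigcup_(S in F) S) `&` U.
  have FW : ~ F W.
    by have [w Ww] := DU0 => FW; case: (Ww) => + _; apply; exists W.
  have disjW S z : F S -> S z -> W z -> False.
    by move=> FS Sz [+ _]; apply; exists S.
  apply: (Fmax (F `|` [set W])).
    rewrite properEneq; split; last exact: subsetUl.
    by apply/eqP => E; apply: FW; rewrite E; right.
  split.
  - by move=> S [/FP//|->].
  - move=> S S' z [FS|->] [FS'|->] Sz S'z //; first exact: Fdisj Sz S'z.
      by have := disjW _ _ FS Sz S'z.
    by have := disjW _ _ FS' S'z Sz.
  - have -> : \bigcup_(S in F `|` [set W]) S = (\bigcup_(S in F) S) `|` U.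
      by rewrite bigcup_setU bigcup_set1 /W setUIr setUv setTI.
    exact: openU.
  (* A set meeting the old union is handled by the old family; otherwise it lies
     in the complement, where the open set U carves out the new member. *)
  - move=> A AFW.
    have [|nA] := pselect (A `&` \bigcup_(S in F) S !=set0).
      move=> /Ffrag[V [S FS [oV AV0 AVS]]].
      by exists V, S => //; left.
    have AD z : A z -> (~` \bigcup_(S in F) S) z.
      by move=> Az Dz; apply: nA; exists z.
    exists U, W; first by right.
    split=> //; last by move=> z [Az Uz]; split=> //; exact: AD.
    have [z [Az [S [FS|->] Sz]]] := AFW; last by exists z; split=> //; case: Sz.
    by have := AD _ Az; case; exists S.
have [f Ff] := choice cover.
exists f; split.
  move=> A [y Ay].
  have [|U [S FS [oU AU0 AUS]]] := Ffrag A.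
    by exists y; split=> //; exists (f y); case: (Ff y).
  exists U; split=> // z w /AUS Sz /AUS Sw.
  have e v : S v -> f v = S.
    by move=> Sv; have [Ffv fvv] := Ff v; exact: Fdisj fvv Sv.
  by rewrite !e.
move=> y; have [Ffy _] := Ff y; exists (f y); first exact: FP.
by move=> z <-; case: (Ff z).
Qed.

End fragmenting_maps.

(** * The metric of a countable separating family *)

Section metric_of_maps.
Variables (R : realType) (Y : topologicalType) (I : countType) (T : Type).
Variable f : I -> Y -> T.

Let seps (y z : Y) : set R :=
  [set x | x = 0 \/ exists2 i, f i y <> f i z & x = (pickle i).+1%:R^-1].

(** A supremum rather than the value at the least separating index: it needs no
search for a minimum and vanishes when no index separates. The value 0 is added
to the set so that it is never empty. *)
Definition first_difference (y z : Y) : R := sup (seps y z).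

Let seps0 y z : seps y z !=set0. Proof. by exists 0; left. Qed.

Let seps_le1 y z : has_ubound (seps y z).
Proof.
exists 1 => _ [->|[i _ ->]]//; rewrite invf_le1//; by rewrite ler1n.
Qed.

Lemma first_difference_ge y z i : f i y <> f i z ->
  (pickle i).+1%:R^-1 <= first_difference y z.
Proof. by move=> ne; apply: ub_le_sup => //; right; exists i. Qed.

Lemma first_difference_ge0 y z : 0 <= first_difference y z.
Proof. by apply: ub_le_sup => //; left. Qed.

Lemma first_difference_le y z (r : R) : 0 <= r ->
  (forall i, f i y <> f i z -> (pickle i).+1%:R^-1 <= r) ->
  first_difference y z <= r.
Proof.
move=> r0 H; apply: ge_sup => // _ [->//|[i ne ->]]; exact: H.
Qed.

Lemma first_difference_metric :
  (forall y z, (forall i, f i y = f i z) -> y = z) ->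
  is_metric first_difference.
Proof.
move=> sepf; split.
- move=> x; apply/le_anti; rewrite first_difference_ge0 andbT.
  exact: first_difference_le.
- move=> x y xy0; apply: sepf => i; apply: contrapT => /first_difference_ge.
  by rewrite xy0 leNgt invr_gt0 ltr0Sn.
- suff le x y : first_difference x y <= first_difference y x.
    by move=> x y; apply/le_anti; rewrite !le.
  apply: first_difference_le; first exact: first_difference_ge0.
  by move=> i ne; apply: first_difference_ge => /esym.
- move=> x y z; apply: first_difference_le => [|i ne].
    by rewrite addr_ge0 ?first_difference_ge0.
  have [xy|xy] := pselect (f i x = f i y).
    rewrite -[leLHS]add0r lerD ?first_difference_ge0 ?first_difference_ge//.
    by rewrite -xy.
  by rewrite -[leLHS]addr0 lerD ?first_difference_ge0 ?first_difference_ge.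
Qed.

(** To reach diameter 1/(n+1), only the finitely many maps with code below n
have to be made constant. *)
Lemma first_difference_fragmented :
  (forall i, fragmenting (f i)) -> fragmented first_difference.
Proof.
move=> Ff e e0 A A0.
(* The family is reindexed by all natural numbers: codes of no index get the
   constant map None. *)
pose g k y := omap (f^~ y) (@unpickle I k).
have Fg k : fragmenting (g k).
  rewrite /g; case: unpickle => [i|] B B0 /=.
    have [U [oU BU0 fU]] := Ff i B B0.
    by exists U; split=> // y z BUy BUz; rewrite (fU y z).
  by exists setT; rewrite setIT; split=> //; exact: openT.
have [n _ /= ne] := near_infty_natSinv_lt (PosNum e0).
have {}ne := ne n (leqnn n).
have [U [oU AU0 gU]] := fragmenting_mkseq n Fg A0.
exists U; split=> //; apply: (@le_lt_trans _ _ (n.+1%:R^-1)%:E).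
  apply: ub_ereal_sup => _ [y AUy [z AUz <-]].
  rewrite lee_fin; apply: first_difference_le => [|i ne_i].
    by rewrite invr_ge0.
  have [lin|nli] := ltnP (pickle i) n.
    have := mkseq_eq_nth lin (gU y z AUy AUz).
    by rewrite /g pickleK /= => -[].
  by rewrite lef_pV2 ?posrE ?ltr0Sn// ler_nat ltnS.
by rewrite lte_fin.
Qed.

Lemma first_difference_open (U : set Y) :
  (forall y, U y -> exists i, forall z, f i y = f i z -> U z) ->
  metric_open first_difference U.
Proof.
move=> fU y Uy; have [i iU] := fU y Uy.
exists (pickle i).+1%:R^-1; first by rewrite invr_gt0 ltr0Sn.
move=> z /= lt; apply: iU; apply: contrapT => /first_difference_ge.
by rewrite leNgt lt.
Qed.

End metric_of_maps.

(** * The Hahn-Banach theorem *)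

Section sublinear.
Variables (R : realType) (V : lmodType R).
Implicit Types (p q u : V -> R) (x y : V).

(** The homogeneity inequality implies the equality, by applying it to the
inverse scalar. *)
Definition sublinear p :=
  (forall x y, p (x + y) <= p x + p y) /\
  (forall t x, 0 < t -> p (t *: x) <= t * p x).

Lemma sublinear0 p : sublinear p -> p 0 = 0.
Proof.
move=> [pD pZ]; have := pD 0 0; rewrite addr0 => h1.
have /(_ _) := pZ 2^-1 0; rewrite scaler0 => h2.
have {}h2 := h2 _; have : (0:R) < 2^-1 by rewrite invr_gt0 ltr0Sn.
by move/h2 => h3; lra.
Qed.

Lemma sublinearN_ge p x : sublinear p -> - p (- x) <= p x.
Proof.
move=> sp; have := proj1 sp x (- x); rewrite subrr sublinear0// => h; lra.
Qed.

(** Serves for infima over a chain of functionals, over a ray, and over a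
subspace (a distance function). *)
Lemma sublinear_inf (G : V -> set R) :
  (forall x, G x !=set0) -> (forall x, has_lbound (G x)) ->
  (forall x y a b, G x a -> G y b -> exists2 c, G (x + y) c & c <= a + b) ->
  (forall t x a, 0 < t -> G x a -> exists2 c, G (t *: x) c & c <= t * a) ->
  sublinear (fun x => inf (G x)).
Proof.
move=> G0 Gl GD GZ; split=> [x y|t x t0].
  rewrite -lerBlDr; apply: lb_le_inf => // a Ga.
  rewrite lerBlDr -lerBlDl; apply: lb_le_inf => // b Gb.
  rewrite lerBlDl; have [c Gc] := GD _ _ _ _ Ga Gb.
  by apply: le_trans; exact: ge_inf.
rewrite -ler_pdivrMl//; apply: lb_le_inf => // a Ga; rewrite ler_pdivrMl//.
have [c Gc] := GZ _ _ _ t0 Ga.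
by apply: le_trans; exact: ge_inf.
Qed.

(** The functional with value inf_(t >= 0) (q (x + t x0) - t q x0) at x is the
largest sublinear q' below q such that q' (- x0) <= - q x0. It serves twice:
minimal functionals must coincide with it, which makes them odd, and starting
from it prescribes the value at x0. *)
Section slope.
Variables (q : V -> R) (x0 : V).
Hypothesis sq : sublinear q.

Let G x := [set q (x + t *: x0) - t * q x0 | t in [set t | 0 <= t]].

Let slope x := inf (G x).

Let G_lbound x : has_lbound (G x).
Proof.
exists (- q (- x)) => _ [t /= t0 <-]; have [qD qZ] := sq.
have : q (t *: x0) <= q (x + t *: x0) + q (- x).
  by apply: le_trans (qD _ _); rewrite addrAC subrr add0r.
suff : t * q x0 <= q (t *: x0) by lra.
have [->|tn0] := eqVneq t 0; first by rewrite mul0r scale0r sublinear0.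
have tp : 0 < t by rewrite lt_neqAle eq_sym tn0.
rewrite -ler_pdivlMl//; apply: le_trans (qZ _ _ _); last by rewrite invr_gt0.
by rewrite scalerA mulVf// scale1r.
Qed.

Lemma sublinear_slope : exists q', [/\ sublinear q', forall x, q' x <= q x &
  q' (- x0) <= - q x0].
Proof.
have [qD qZ] := sq; exists slope; split.
- apply: sublinear_inf => //.
  + by move=> x; exists (q (x + 0 *: x0) - 0 * q x0); exists 0 => /=.
  + move=> x y _ _ [s /= s0 <-] [t /= t0 <-].
    exists (q (x + y + (s + t) *: x0) - (s + t) * q x0).
      by exists (s + t) => //=; exact: addr_ge0.
    rewrite scalerDl addrACA mulrDl.
    by have := qD (x + s *: x0) (y + t *: x0); lra.
  + move=> t x _ t0 [s /= s0 <-].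
    exists (q (t *: x + (t * s) *: x0) - (t * s) * q x0).
      by exists (t * s) => //=; rewrite mulr_ge0// ltW.
    by rewrite mulrBr mulrA lerB// -scalerA -scalerDr qZ.
- by move=> x; apply: ge_inf => //; exists 0 => //=;
    rewrite scale0r addr0 mul0r subr0.
- by apply: ge_inf => //; exists 1 => //=;
    rewrite scale1r mul1r addNr sublinear0// sub0r.
Qed.

End slope.

Lemma minimal_sublinear p : sublinear p -> exists q, [/\ sublinear q,
  forall x, q x <= p x &
  forall r, sublinear r -> (forall x, r x <= q x) -> forall x, q x <= r x].
Proof.
move=> sp.
pose S := {q : V -> R | sublinear q /\ forall x, q x <= p x}.
pose below (q r : S) := `[< forall x, sval r x <= sval q x >].
have p_in : sublinear p /\ forall x, p x <= p x by [].
have [|||[q [sq qp]] qmin] := @ZL_preorder S (exist _ p p_in) below.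
- by move=> q; apply/asboolP.
- move=> q r s /asboolP qr /asboolP rs; apply/asboolP => x.
  exact: le_trans (rs x) (qr x).
- move=> A Atot.
  have [[q0 Aq0]|A0] := pselect (A !=set0); last first.
    by exists (exist _ p p_in) => s As; exfalso; apply: A0; exists s.
  pose G x := [set sval q x | q in A].
  have Gl x : has_lbound (G x).
    exists (- p (- x)) => _ [[q [sq qp]] _ <-] /=.
    by rewrite (le_trans _ (sublinearN_ge x sq))// lerN2.
  have Gle (q : S) x : A q -> inf (G x) <= sval q x.
    by move=> Aq; apply: ge_inf => //; exists q.
  have sG : sublinear (fun x => inf (G x)).
    apply: sublinear_inf => //.
    + by move=> x; exists (sval q0 x); exists q0.
    + move=> x y _ _ [q Aq <-] [r Ar <-].
      have [/asboolP qr|/asboolP rq] := Atot _ _ Aq Ar.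
        exists (sval r (x + y)); first by exists r.
        have [[rD _] _] := svalP r.
        by apply: le_trans (rD _ _) _; rewrite lerD2r.
      exists (sval q (x + y)); first by exists q.
      have [[qD _] _] := svalP q.
      by apply: le_trans (qD _ _) _; rewrite lerD2l.
    + move=> t x _ t0 [q Aq <-]; exists (sval q (t *: x)); first by exists q.
      by have [[_ qZ] _] := svalP q; exact: qZ.
  have Gp x : inf (G x) <= p x.
    by apply: le_trans (Gle q0 x Aq0) _; case: (svalP q0).
  exists (exist _ (fun x => inf (G x)) (conj sG Gp)) => q Aq.
  by apply/asboolP => x /=; exact: Gle.
exists q; split=> // r sr rq.
have rp x : r x <= p x by exact: le_trans (rq x) (qp x).
have h : below (exist _ q (conj sq qp)) (exist _ r (conj sr rp)).
  exact/asboolP.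
by have /asboolP := qmin _ h.
Qed.

(** A minimal sublinear functional u is linear: it cannot be improved by
[sublinear_slope], hence it is odd, and an odd subadditive functional is
additive. *)
Theorem Hahn_Banach p x0 : sublinear p ->
  exists u, [/\ scalar u, forall x, u x <= p x & u x0 = p x0].
Proof.
move=> /(sublinear_slope x0)[p' [sp' p'p p'N]].
have [u [su up' umin]] := minimal_sublinear sp'.
have uN x : u (- x) = - u x.
  have [r [sr ru rN]] := sublinear_slope x su.
  apply/le_anti; rewrite (le_trans (umin r sr ru _) rN) /=.
  by have := sublinearN_ge x su; lra.
have uD x y : u (x + y) = u x + u y.
  have [h _] := su; apply/le_anti; rewrite h /=.
  by have := h (- x) (- y); rewrite -opprD !uN; lra.
have uZpos t x : 0 < t -> u (t *: x) = t * u x.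
  have [_ h] := su => t0; apply/le_anti; rewrite h //=.
  rewrite -ler_pdivlMl//; apply: le_trans (h _ _ _); last by rewrite invr_gt0.
  by rewrite scalerA mulVf ?gt_eqF// scale1r.
have uZ t x : u (t *: x) = t * u x.
  have [t0|t0|->] := ltgtP t 0; last by rewrite scale0r mul0r sublinear0.
    by rewrite -[t in LHS]opprK scaleNr uN uZpos ?oppr_gt0// mulNr opprK.
  exact: uZpos.
exists u; split.
- by move=> t x y; rewrite uD uZ.
- by move=> x; exact: le_trans (up' x) (p'p x).
- apply/le_anti; rewrite (le_trans (up' x0) (p'p x0)) /=.
  by have := up' (- x0); rewrite uN; lra.
Qed.

End sublinear.

(** * Approximation by rational combinations *)

Section rational_combinations.
Variables (R : realType) (V : lmodType R) (N : V -> R).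
Hypothesis ND : forall x y, N (x + y) <= N x + N y.
Hypothesis NZ : forall t x, N (t *: x) = `|t| * N x.

Lemma seminorm0 : N 0 = 0.
Proof. by rewrite -[0 : V](scale0r 0) NZ normr0 mul0r. Qed.

Lemma seminormN x : N (- x) = N x.
Proof. by rewrite -scaleN1r NZ normrN1 mul1r. Qed.

Lemma seminorm_ge0 x : 0 <= N x.
Proof.
by have := ND x (- x); rewrite subrr seminorm0 seminormN => h; lra.
Qed.

Lemma seminormB x y : N (x - y) = N (y - x).
Proof. by rewrite -seminormN opprB. Qed.

Definition rational_combination (a : nat -> V) (q : seq rat) : V :=
  \sum_(i < size q) ratr q`_i *: a i.

Variable a : nat -> V.
Local Notation comb := (rational_combination a).

Lemma rational_combinationE q n : (size q <= n)%N ->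
  comb q = \sum_(i < n) ratr q`_i *: a i.
Proof.
move=> qn; rewrite /rational_combination 
  (big_ord_widen _ (fun i => ratr q`_i *: a i) qn).
rewrite big_mkcond /=; apply: eq_bigr => i _; case: ltnP => // qi.
by rewrite nth_default// rmorph0 scale0r.
Qed.

Lemma rational_combination_mkseq (c : nat -> rat) n :
  comb (mkseq c n) = \sum_(i < n) ratr (c i) *: a i.
Proof.
rewrite (@rational_combinationE _ n) ?size_mkseq//.
by apply: eq_bigr => i _; rewrite nth_mkseq.
Qed.

Lemma rational_combinationD q r : exists s, comb s = comb q + comb r.
Proof.
pose n := maxn (size q) (size r).
exists (mkseq (fun i => q`_i + r`_i) n).
rewrite rational_combination_mkseq (@rational_combinationE q n) ?leq_maxl//.
rewrite (@rational_combinationE r n) ?leq_maxr// -big_split /=.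
by apply: eq_bigr => i _; rewrite rmorphD scalerDl.
Qed.

Lemma rational_combinationZ (t : rat) q :
  exists s, comb s = (ratr t : R) *: comb q.
Proof.
exists (mkseq (fun i => t * q`_i) (size q)).
rewrite rational_combination_mkseq scaler_sumr.
by apply: eq_bigr => i _; rewrite rmorphM scalerA.
Qed.

Lemma rational_combination_gen n : exists q, comb q = a n.
Proof.
exists (mkseq (fun i => (i == n)%:R) n.+1).
rewrite rational_combination_mkseq big_ord_recr /= eqxx rmorph1 scale1r.
rewrite big1 ?add0r// => i _.
by rewrite ltn_eqF// rmorph0 scale0r.
Qed.

(* The closure of the rational span; it is a real subspace. *)
Let M : set V := [set m | forall e : R, 0 < e -> exists q, N (m - comb q) < e].

Let M_comb q : M (comb q).
Proof. by move=> e e0; exists q; rewrite subrr seminorm0. Qed.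

Let MD x y : M x -> M y -> M (x + y).
Proof.
move=> Mx My e e0; have e2 : 0 < e / 2 by rewrite divr_gt0.
have [q qx] := Mx _ e2; have [r ry] := My _ e2.
have [s sE] := rational_combinationD q r; exists s; rewrite sE opprD addrACA.
by apply: le_lt_trans (ND _ _) _; lra.
Qed.

(* A real scalar is first replaced by a rational r at distance less than
   e/2/(N x + 1), then x by a combination within e/2/(|r| + 1); the added 1
   avoids dividing by zero. *)
Let MZ t x : M x -> M (t *: x).
Proof.
move=> Mx e e0; have N0 := seminorm_ge0.
have [r /andP[r1 r2]] : exists r : rat, t - e / 2 / (N x + 1) < ratr r < t.
  have : t - e / 2 / (N x + 1) < t.
    by rewrite ltrBlDr ltrDl !divr_gt0// ltr_wpDl.
  by move/rat_in_itvoo => [r]; rewrite in_itv /=; exists r.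
have d0 : 0 < e / 2 / (`|ratr r : R| + 1) by rewrite !divr_gt0// ltr_wpDl.
have [q qx] := Mx _ d0.
have [s sE] := rational_combinationZ r q; exists s; rewrite sE.
have -> : t *: x - (ratr r : R) *: comb q =
    (t - ratr r) *: x + (ratr r : R) *: (x - comb q).
  by rewrite scalerBl scalerBr addrA subrK.
apply: le_lt_trans (ND _ _) _; rewrite !NZ.
have h1 : `|t - ratr r| * N x < e / 2.
  have tr : `|t - ratr r| < e / 2 / (N x + 1).
    by rewrite gtr0_norm ?subr_gt0//; lra.
  apply: (@le_lt_trans _ _ (`|t - ratr r| * (N x + 1))).
    by rewrite ler_wpM2l// lerDl.
  by rewrite -ltr_pdivlMr// ltr_wpDl.
have h2 : `|ratr r| * N (x - comb q) <= e / 2.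
  apply: (@le_trans _ _ ((`|ratr r : R| + 1) * N (x - comb q))).
    by rewrite ler_wpM2r// lerDl.
  by rewrite mulrC -ler_pdivlMr ?ltr_wpDl// ltW.
lra.
Qed.

(** Otherwise the distance to the closed rational span is positive at x, and a
linear functional dominated by this distance, with the same value at x,
vanishes on the span but not at x. Rational coefficients keep the set of
combinations countable. *)
Lemma rational_span_dense x :
  (forall u : V -> R, scalar u -> (forall y, u y <= N y) ->
    (forall n, u (a n) = 0) -> u x = 0) ->
  forall e : R, 0 < e -> exists q, N (x - comb q) <= e.
Proof.
move=> Hx e e0; apply: contrapT => /forallNP far.
have N0 := seminorm_ge0; have e2 : 0 < e / 2 by rewrite divr_gt0.
pose G v := [set N (v - m) | m in M].
have M0 : M 0 by rewrite -(scale0r (comb [::])); apply: MZ.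
have Gl v : has_lbound (G v) by exists 0 => _ [m _ <-].
have sG : sublinear (fun v => inf (G v)).
  apply: sublinear_inf => //.
  - by move=> v; exists (N (v - 0)); exists 0.
  - move=> v w _ _ [m Mm <-] [k Mk <-]; exists (N (v + w - (m + k))).
      by exists (m + k) => //; exact: MD.
    by rewrite opprD addrACA.
  - move=> t v _ t0 [m Mm <-]; exists (N (t *: v - t *: m)).
      by exists (t *: m) => //; exact: MZ.
    by rewrite -scalerBr NZ gtr0_norm.
have [u [su uG ux]] := Hahn_Banach x sG.
have G0 m : M m -> u m <= 0.
  move=> Mm; apply: le_trans (uG m) _; apply: ge_inf => //.
  by exists m => //; rewrite subrr seminorm0.
have uE m : M m -> u m = 0.
  move=> Mm; apply/le_anti; rewrite G0//=.
  have := G0 ((-1) *: m) (MZ _ Mm).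
  have := su (-1) m 0; rewrite addr0 => ->.
  have := su 1 0 0; rewrite !scale1r addr0 => h; move: h => /= h1 h2.
  by lra.
have : e / 2 <= u x.
  rewrite ux; apply: lb_le_inf; first by exists (N (x - 0)); exists 0.
  move=> _ [m Mm <-]; have [q qm] := Mm _ e2.
  have := far q; have := ND (x - m) (m - comb q); rewrite addrA subrK.
  by move=> h1 /negP; rewrite -ltNge => h2; lra.
rewrite Hx//; first lra.
- move=> y; apply: le_trans (uG y) _; apply: ge_inf => //.
  by exists 0 => //; rewrite subr0.
- move=> n; apply: uE; have [q <-] := rational_combination_gen n.
  exact: M_comb.
Qed.

End rational_combinations.

(** * Slices on which the norm of midpoints is nearly constant *)

Section norm_slices.
Variables (R : realType) (V : lmodType R) (N : V -> R).
Hypothesis ND : forall x y, N (x + y) <= N x + N y.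
Hypothesis NZ : forall t x, N (t *: x) = `|t| * N x.
(* Y is the space with its weak topology, V the real vector space below it; the
   only link needed between them is that dominated functionals have open
   superlevel sets. *)
Variables (Y : topologicalType) (vec : Y -> V).
Hypothesis open_half_space : forall u : V -> R, scalar u ->
  (forall x, u x <= N x) -> forall c, open [set y | c < u (vec y)].

Lemma seminorm_sublinear : sublinear N.
Proof. by split=> // t x t0; rewrite NZ gtr0_norm. Qed.

Lemma scalar_add (u : V -> R) x y : scalar u -> u (x + y) = u x + u y.
Proof. by move=> su; have := su 1 x y; rewrite scale1r mul1r. Qed.

Lemma scalar_scale (u : V -> R) t x : scalar u -> u (t *: x) = t * u x.
Proof.
move=> su; have := su t x 0; rewrite addr0 => ->.
by have := scalar_add 0 0 su; rewrite addr0 => h; lra.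
Qed.

(** The norm is the supremum of the functionals that it dominates. *)
Lemma open_norm_gt z c : open [set y | c < N (vec y - z)].
Proof.
pose D := [set u : V -> R | scalar u /\ forall x, u x <= N x].
have -> : [set y | c < N (vec y - z)] =
    \bigcup_(u in D) [set y | c + u z < u (vec y)].
  apply/seteqP; split=> [y /= cy|y [u [su uN]] /= cy].
    have [u [su uN ux]] := Hahn_Banach (vec y - z) seminorm_sublinear.
    exists u => //=; rewrite -[vec y in ltRHS](subrK z) scalar_add// ux.
    by rewrite ltrD2r.
  apply: lt_le_trans (uN _).
  by rewrite scalar_add// -scaleN1r scalar_scale//; lra.
by apply: bigcup_open => u [su uN]; exact: open_half_space.
Qed.

(** The first alternative absorbs unbounded sets: it never holds for a set
containing a given point once n is large. In the second one, the case y = z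
bounds the norms of the points themselves from below. *)
Definition norm_slice (n : nat) (A : set Y) :=
  (forall y, A y -> n%:R < N (vec y)) \/
  exists s, forall y z, A y -> A z ->
    N (vec y) <= s /\ s - n.+1%:R^-1 < N (2^-1 *: (vec y + vec z)).

Lemma norm_slice_relatively_open n (A : set Y) : A !=set0 ->
  exists U, [/\ open U, A `&` U !=set0 & norm_slice n (A `&` U)].
Proof.
move=> A0; pose B := [set y | n%:R < N (vec y)].
have oB : open B.
  by have := open_norm_gt 0 n%:R; under eq_set do rewrite subr0.
have [AB|nAB] := pselect (A `&` B !=set0).
  by exists B; split=> //; left=> y [].
have AN y : A y -> N (vec y) <= n%:R.
  by move=> Ay; rewrite leNgt; apply/negP => By; apply: nAB; exists y.
pose E := [set N (vec y) | y in A]; pose s := sup E.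
have [y0 Ay0] := A0.
have supE : has_sup E.
  split; first by exists (N (vec y0)); exists y0.
  by exists n%:R => _ [y Ay <-]; exact: AN.
have d0 : 0 < n.+1%:R^-1 :> R by rewrite invr_gt0 ltr0Sn.
have [_ [y Ay <-] ys] := sup_adherent d0 supE.
have [u [su uN uy]] := Hahn_Banach (vec y) seminorm_sublinear.
exists [set z | s - n.+1%:R^-1 < u (vec z)]; split.
- exact: open_half_space.
- by exists y; split=> //=; rewrite uy.
- right; exists s => z w [Az uz] [Aw uw]; split.
    by apply: ub_le_sup; [case: supE | exists z].
  apply: lt_le_trans (uN _); rewrite scalar_scale// scalar_add//.
  have avg (b c d : R) : b < c -> b < d -> b < 2^-1 * (c + d) by lra.
  exact: avg uz uw.
Qed.

Lemma norm_slice_maps : exists f : nat -> Y -> set Y,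
  (forall n, fragmenting (f n)) /\
  forall n y z, f n y = f n z -> N (vec z) <= n%:R ->
    `|N (vec z) - N (vec y)| < n.+1%:R^-1 /\
    `|N (vec z) - N (2^-1 *: (vec y + vec z))| < n.+1%:R^-1.
Proof.
have /choice[f fP] : forall n, exists f : Y -> set Y, fragmenting f /\
    forall y, exists2 S, norm_slice n S & forall z, f z = f y -> S z.
  move=> n; apply: fragmenting_of_small => A.
  exact: norm_slice_relatively_open.
exists f; split=> [n|n y z yz zn]; first by case: (fP n).
have [_ /(_ z)[S [Sn|[s Ss]] fS]] := fP n.
  by have := Sn z (fS z erefl); rewrite ltNge zn.
have [Sy Sz] := (fS y yz, fS z erefl).
have mid w : 2^-1 *: (w + w) = w :> V.
  by rewrite -[w]scale1r -scalerDl scalerA; congr (_ *: _); lra.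
have [Ny ] := Ss y y Sy Sy; rewrite mid => Ny'.
have [Nz ] := Ss z z Sz Sz; rewrite mid => Nz'.
have [_ Nyz] := Ss y z Sy Sz.
have Nm : N (2^-1 *: (vec y + vec z)) <= s.
  rewrite NZ ger0_norm ?invr_ge0//; have := ND (vec y) (vec z).
  by move: Ny Nz => /=; lra.
move: (n.+1%:R^-1 : R) Ny Ny' Nz Nz' Nyz Nm => d Ny Ny' Nz Nz' Nyz Nm.
by rewrite !ltr_norml; split; apply/andP; split; lra.
Qed.

Lemma eventually_resolved (c e : R) : 0 < e ->
  \forall n \near \oo, c <= n%:R /\ n.+1%:R^-1 < e.
Proof.
move=> e0; near=> n; split; near: n; first exact: nbhs_infty_ger.
exact: (near_infty_natSinv_lt (PosNum e0)).
Unshelve. all: by end_near. Qed.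

Theorem rotund_fragmentable : injective vec ->
  (forall x y, N x = N y -> N (2^-1 *: (x + y)) = N x -> x = y) ->
  exists rho : Y -> Y -> R, is_metric rho /\ fragmented rho.
Proof.
move=> vec_inj rot; have [f [Ff fP]] := norm_slice_maps.
exists (first_difference R f); split; last exact: first_difference_fragmented.
apply: first_difference_metric => y z fyz; apply: vec_inj.
have close (a b : R) : (forall n, N (vec z) <= n%:R -> `|a - b| < n.+1%:R^-1) ->
    a = b.
  move=> H; apply/eqP; rewrite -subr_eq0 -normr_eq0 eq_le normr_ge0 andbT.
  rewrite leNgt; apply/negP => ab0.
  have [n [zn ne]] := filter_ex (eventually_resolved (N (vec z)) ab0).
  by have := lt_trans (H n zn) ne; rewrite ltxx.
have e1 : N (vec z) = N (vec y) by apply: close => n /(fP n y z (fyz n))[].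
have e2 : N (vec z) = N (2^-1 *: (vec y + vec z)).
  by apply: close => n /(fP n y z (fyz n))[].
by apply: rot; rewrite -?e2 e1.
Qed.

(** The second property makes every vector computed from representatives a
function of finitely many colours. *)
Lemma representatives (T : Type) (f : Y -> T) : exists r : Y -> Y,
  (forall y, f (r y) = f y) /\ forall y z, f y = f z -> r y = r z.
Proof.
have /choice[g gP] : forall t, exists o, forall y, f y = t ->
    exists2 z, o = Some z & f z = t.
  move=> t; have [[y yt]|nt] := pselect (exists y, f y = t).
    by exists (Some y) => _ _; exists y.
  by exists None => y yt; exfalso; apply: nt; exists y.
exists (fun y => odflt y (g (f y))); split=> [y|y z yz].
  by have [z ->] := gP _ y erefl.
by rewrite -yz; have [w ->] := gP _ y erefl.
Qed.

(** On a fibre of F the centre c y is fixed, and the complement of a closed ball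
around it is open: a set either meets this complement or lies in the ball. *)
Lemma fragmenting_dist (T : Type) (F : Y -> T) (c : Y -> V) (r : R) :
  fragmenting F -> (forall y z, F y = F z -> c y = c z) ->
  fragmenting (fun y => (F y, `[< N (vec y - c y) <= r >])).
Proof.
move=> FF Fc A A0; have [U [oU [y0 [Ay0 Uy0]] FU]] := FF A A0.
have cU y : (A `&` U) y -> c y = c y0 by move=> Ay; apply/Fc/FU.
have [[y [AUy Wy]]|nW] :=
    pselect ((A `&` U) `&` [set y | r < N (vec y - c y0)] !=set0).
  exists (U `&` [set y | r < N (vec y - c y0)]); split.
  - by apply: openI => //; exact: open_norm_gt.
  - by exists y; case: AUy.
  - have far z : (A `&` (U `&` [set y | r < N (vec y - c y0)])) z ->
        `[< N (vec z - c z) <= r >] = false.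
      move=> [Az [Uz Wz]]; apply/asboolP; rewrite cU//.
      by apply/negP; rewrite -ltNge.
    move=> z w Az Aw; rewrite !far//; congr (_, _).
    by apply: FU; [case: Az => ? [] | case: Aw => ? []].
exists U; split=> //; first by exists y0.
have near z : (A `&` U) z -> `[< N (vec z - c z) <= r >] = true.
  move=> AUz; apply/asboolP; rewrite cU// leNgt; apply/negP => Wz.
  by apply: nW; exists z.
by move=> z w Az Aw; rewrite !near// (FU z w).
Qed.

Theorem wLUR_fragmented : injective vec -> (forall x, N x = 0 -> x = 0) ->
  (forall (x : V) (a : nat -> V),
    N (2^-1 *: (a n + x)) @[n --> \oo] --> N x ->
    N (a n) @[n --> \oo] --> N x ->
    forall u : V -> R, scalar u -> (forall y, u y <= N y) ->
    u (a n) @[n --> \oo] --> u x) ->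
  exists rho : Y -> Y -> R, [/\ is_metric rho, fragmented rho &
    forall U : set Y,
      (forall y, U y -> exists2 e : R, 0 < e &
        forall z, N (vec z - vec y) < e -> U z) ->
      metric_open rho U].
Proof.
move=> vec_inj N_eq0 wLUR; have [f [Ff fP]] := norm_slice_maps.
have /choice[r rP] := fun n => representatives (f n).
pose a y n := vec (r n y).
have aN y : N (a y n) @[n --> \oo] --> N (vec y).
  apply/cvgrPdist_lt => e e0.
  apply: filterS (eventually_resolved (N (vec y)) e0) => n [yn ne].
  by have [h _] := fP n (r n y) y (proj1 (rP n) y) yn; exact: lt_trans ne.
have amid y : N (2^-1 *: (a y n + vec y)) @[n --> \oo] --> N (vec y).
  apply/cvgrPdist_lt => e e0.
  apply: filterS (eventually_resolved (N (vec y)) e0) => n [yn ne].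
  by have [_ h] := fP n (r n y) y (proj1 (rP n) y) yn; exact: lt_trans ne.
pose F (q : seq rat) y := mkseq (f^~ y) (size q).
pose c (q : seq rat) y := rational_combination (a y) q.
have Fc q y z : F q y = F q z -> c q y = c q z.
  move=> Fyz; apply: eq_bigr => i _; congr (_ *: vec _).
  by apply: (proj2 (rP i)); exact: mkseq_eq_nth Fyz.
pose h (i : seq rat * nat) y :=
  (F i.1 y, `[< N (vec y - c i.1 y) <= i.2.+1%:R^-1 >]).
have Fh i : fragmenting (h i).
  by apply: fragmenting_dist; [exact: fragmenting_mkseq | exact: Fc].
(* Sharing the colour of y for a suitable (q, m) forces norm distance below e:
   both points lie in the ball of radius 1/(m+1) around the same z_q. *)
have hP y (e : R) : 0 < e ->
    exists i, forall z, h i y = h i z -> N (vec z - vec y) < e.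
  move=> e0; have e2 : 0 < e / 2 by rewrite divr_gt0.
  have [m [_ me]] := filter_ex (eventually_resolved 0 e2).
  have m0 : 0 < m.+1%:R^-1 :> R by rewrite invr_gt0 ltr0Sn.
  have [|q yq] := rational_span_dense ND NZ _ m0 (a := a y) (x := vec y).
    move=> u su uN ua0.
    have := wLUR _ _ (amid y) (aN y) u su uN.
    under eq_cvg do rewrite ua0.
    move=> u0; apply: (cvg_unique _ u0 (cvg_cst (0 : R))) => //.
  exists (q, m) => z [Fyz]; rewrite (asboolT yq) => /esym/asboolP zq.
  have := ND (vec z - c q z) (c q y - vec y).
  rewrite (Fc _ _ _ Fyz) addrA subrK -(Fc _ _ _ Fyz).
  rewrite (seminormB NZ (c q y)) => hN; apply: le_lt_trans hN _.
  rewrite -(Fc _ _ _ Fyz) in zq; rewrite [e]splitr.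
  by apply: ltrD; [exact: le_lt_trans me | exact: le_lt_trans me].
exists (first_difference R h); split.
- apply: first_difference_metric => y z yz; apply: vec_inj.
  apply/eqP; rewrite eq_sym -subr_eq0; apply/eqP/N_eq0; apply: contrapT => N0.
  have Npos : 0 < N (vec z - vec y).
    by rewrite lt_neqAle eq_sym seminorm_ge0// andbT; exact/eqP.
  by have [i /(_ z (yz i))] := hP y _ Npos; rewrite ltxx.
- exact: first_difference_fragmented.
- move=> U openU; apply: first_difference_open => y /openU[e e0 eU].
  by have [i iP] := hP y e e0; exists i => z /iP; exact: eU.
Qed.

End norm_slices.

(** * Restriction of scalars to the reals *)

(** The embedding e is a parameter of the type, so that the type determines the
action of R. *)
Definition restrict_scalars (R : realType) (K : numFieldType)
  (e : {rmorphism R -> K}) (X : normedModType K) : Type := X.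

Section restrict_scalars.
Variables (R : realType) (K : numFieldType) (e : {rmorphism R -> K}).
Variable (X : normedModType K).
Local Notation V := (restrict_scalars e X).

HB.instance Definition _ := GRing.Zmodule.copy V X.

Let scale (r : R) (x : V) : V := e r *: (x : X).

Let scaleA r s v : scale r (scale s v) = scale (r * s) v.
Proof. by rewrite /scale scalerA rmorphM. Qed.

Let scale1 : left_id 1 scale.
Proof. by move=> x; rewrite /scale rmorph1 scale1r. Qed.

Let scaleDr : right_distributive scale +%R.
Proof. by move=> r x y; rewrite /scale scalerDr. Qed.

Let scaleDl v : {morph scale^~ v : r s / r + s}.
Proof. by move=> r s; rewrite /scale rmorphD scalerDl. Qed.

HB.instance Definition _ :=
  GRing.Zmodule_isLmodule.Build R V scaleA scale1 scaleDr scaleDl.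

Lemma restrict_scalarsE (r : R) (x : V) : r *: x = (e r *: (x : X)) :> X.
Proof. by []. Qed.
End restrict_scalars.

Lemma weak_continuous (K : numFieldType) (X : normedModType K) (f : dual X) :
  continuous (sval f : weak X -> K^o).
Proof.
move=> x.
have /cvg_sup/(_ f) h : nbhs (x : weak X) --> (x : weak X) by [].
exact: cvg_trans (cvg_app (sval f : X -> K^o) h)
  (@initial_continuous _ _ (sval f : X -> K^o) x).
Qed.

(** * Fragmentation of the weak topology *)

Section weak_fragmentation.
Variables (R : realType) (K : numFieldType) (e : {rmorphism R -> K}).
Variable re : K -> R.
(* The norm of X has its values in K; re reads them in R, and e converts them
   back. *)
Hypothesis ge0_re : forall k, 0 <= k -> e (re k) = k.
Hypothesis le_e : {mono e : x y / x <= y}.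
Hypothesis re_continuous : continuous (re : K^o -> R).
Variable (X : normedModType K).
Local Notation V := (restrict_scalars e X).
Let N (x : V) : R := re `|x : X|.
Hypothesis extend_scalars : forall u : V -> R, scalar u ->
  (forall x, u x <= N x) -> exists f : dual X, forall x, u x = re (sval f x).

Let eN x : e (N x) = `|x : X|. Proof. exact: ge0_re. Qed.

Let e_inj : injective e. Proof. exact: inc_inj. Qed.

Let lt_e : {mono e : x y / x < y}. Proof. exact: leW_mono. Qed.

Let ND x y : N (x + y) <= N x + N y.
Proof. by rewrite -le_e rmorphD !eN ler_normD. Qed.

Let norm_e r : `|e r| = e `|r|.
Proof.
have [r0|r0] := leP 0 r.
  by rewrite (ger0_norm r0) ger0_norm// -(rmorph0 e) le_e.
by rewrite (ltr0_norm r0) ltr0_norm ?rmorphN// -(rmorph0 e) lt_e.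
Qed.

Let NZ t x : N (t *: x) = `|t| * N x.
Proof.
by apply: e_inj; rewrite rmorphM !eN restrict_scalarsE normrZ norm_e.
Qed.

Let N_eq0 x : N x = 0 -> x = 0.
Proof. by move=> Nx; apply/normr0_eq0; rewrite -eN Nx rmorph0. Qed.

Let open_half_space (u : V -> R) : scalar u -> (forall x, u x <= N x) ->
  forall c, open [set y : weak X | c < u y].
Proof.
move=> su uN c; have [f uf] := extend_scalars su uN.
rewrite (_ : [set _ | _] =
    (re \o (sval f : weak X -> K^o)) @^-1` [set r | c < r]).
  apply: open_comp; last exact: open_gt.
  move=> x _; apply: continuous_comp; first exact: weak_continuous.
  exact: re_continuous.
by apply/seteqP; split=> y /=; rewrite uf.
Qed.

(** If two unit vectors a, b have a midpoint of norm one, then the whole segment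
is on the sphere: the points p and q at parameters s and 1 - s have norm at most
one, and their sum a + b has norm two, so both have norm one. *)
Lemma rotund_midpoint : rotund_norm X -> forall x y : V,
  N x = N y -> N (2^-1 *: (x + y)) = N x -> x = y.
Proof.
move=> rot x y xy mxy.
have [Nx0|/eqP Nx0] := eqVneq (N x) 0.
  by rewrite (N_eq0 Nx0) (N_eq0 (etrans (esym xy) Nx0)).
have Npos : 0 < N x.
  by rewrite lt_neqAle (seminorm_ge0 ND NZ) andbT eq_sym; exact/eqP.
have r0 : (N x)^-1 != 0 by rewrite invr_eq0 gt_eqF.
suff h : (N x)^-1 *: x = (N x)^-1 *: y by exact: (scalerI r0 h).
have unit z : N z = N x -> N ((N x)^-1 *: z) = 1.
  by move=> zx; rewrite NZ zx ger0_norm ?invr_ge0 ?ltW// mulVf// gt_eqF.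
have x1 := unit _ erefl; have y1 := unit _ (esym xy); have m1 := unit _ mxy.
rewrite scalerA mulrC -scalerA scalerDr in m1.
move: ((N x)^-1 *: x) ((N x)^-1 *: y) x1 y1 m1.
move=> {unit Nx0 Npos r0 xy mxy} a b a1 b1 m1.
apply: rot => _ [t /= /andP[t0 t1] <-].
have tE := ge0_re t0; move: (re t) tE t0 t1 => s <-.
rewrite -(rmorph0 e) -(rmorph1 e) !le_e => s0 s1.
pose p := (1 - s) *: a + s *: b; pose q := s *: a + (1 - s) *: b.
have Np : N p <= 1.
  apply: le_trans (ND _ _) _; rewrite !NZ a1 b1 !ger0_norm ?subr_ge0//; lra.
have Nq : N q <= 1.
  apply: le_trans (ND _ _) _; rewrite !NZ a1 b1 !ger0_norm ?subr_ge0//; lra.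
have pq : p + q = a + b.
  by rewrite addrACA -!scalerDl subrK addrC [s + _]addrC subrK !scale1r addrC.
have Nab : 2 <= N p + N q.
  rewrite NZ ger0_norm ?invr_ge0// in m1.
  by have := ND p q; rewrite pq; lra.
rewrite -rmorphB -[LHS](eN p); congr (e _).
by apply/le_anti; rewrite Np /=; lra.
Qed.

Lemma cvg_re_norm (a : nat -> V) (x : V) : N (a n) @[n --> \oo] --> N x ->
  `|a n : X| @[n --> \oo] --> `|x : X|.
Proof.
move=> /cvgrPdist_lt h; apply/cvgrPdist_lt => d d0.
have d1 : 0 < re d by rewrite -lt_e rmorph0 ge0_re// ltW.
apply: filterS (h _ d1) => n.
by rewrite -lt_e ge0_re ?ltW// -norm_e rmorphB !eN.
Qed.

Lemma wLUR_real_functionals : wLUR_norm X -> forall (x : V) (a : nat -> V),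
  N (2^-1 *: (a n + x)) @[n --> \oo] --> N x ->
  N (a n) @[n --> \oo] --> N x ->
  forall u : V -> R, scalar u -> (forall y, u y <= N y) ->
  u (a n) @[n --> \oo] --> u x.
Proof.
move=> wlur x a mid an u su uN; have [f uf] := extend_scalars su uN.
have h : (a n - x : weak X) @[n --> \oo] --> ((0 : X) : weak X).
  apply: wlur; last exact: cvg_re_norm.
  have := cvg_re_norm mid; under eq_cvg do
    rewrite restrict_scalarsE fmorphV rmorph_nat.
  by [].
have fh := cvg_comp _ _ h (@weak_continuous _ _ f (0 : X)).
have rh : re (sval f (a n - x)) @[n --> \oo] --> re (sval f 0).
  apply: (cvg_comp _ _ fh); exact: re_continuous.
have u0 : u 0 = 0 by have := scalar_scale 0 0 su; rewrite scale0r mul0r.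
have uh : u (a n - x) @[n --> \oo] --> (0 : R).
  by move: rh; rewrite -uf u0; under eq_cvg do rewrite -uf.
have -> : (fun n => u (a n)) = (fun n => u (a n - x) + u x).
  by apply/funext => n; rewrite -scalar_add// subrK.
by rewrite -[u x in X in _ --> X]add0r; exact: cvgD uh (cvg_cst (u x)).
Qed.

Theorem weak_fragmentation :
  (rotund_norm X -> exists rho : weak X -> weak X -> R,
     is_metric rho /\ fragmented rho) /\
  (wLUR_norm X -> exists rho : weak X -> weak X -> R,
     [/\ is_metric rho, fragmented rho &
         forall U : set X, open U -> metric_open rho U]).
Proof.
split=> [rot|wlur].
  apply: (rotund_fragmentable ND NZ open_half_space (fun x y h => h)).
  exact: rotund_midpoint.
have [rho [mrho frho orho]] := wLUR_fragmented ND NZ open_half_space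
  (fun x y h => h) N_eq0 (wLUR_real_functionals wlur).
exists rho; split=> // U oU; apply: orho => y Uy.
have /nbhs_ballP[d /= d0 dU] : nbhs (y : X) U by exact: open_nbhs_nbhs.
exists (re d); first by rewrite -lt_e rmorph0 ge0_re// ltW.
move=> z; rewrite -lt_e eN ge0_re ?ltW// => zy; apply: dU.
by rewrite -ball_normE /= distrC.
Qed.

End weak_fragmentation.

(** * Real and complex scalars *)

Lemma linear_bound_continuous (K : numFieldType) (X : normedModType K)
    (f : {linear X -> K^o}) (n : nat) :
  (forall x, `|f x| <= n%:R * `|x|) -> continuous f.
Proof.
move=> fn; apply: bounded_linear_continuous; apply/linear_boundedP.
apply: filterS (nbhs_pinfty_ge (realn _ n)) => r nr x.
by apply: le_trans (fn x) _; rewrite ler_wpM2r.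
Qed.

Lemma sublinear_bound (R : realType) (V : lmodType R) (N u : V -> R) :
  (forall x, N (- x) = N x) -> scalar u -> (forall x, u x <= N x) ->
  forall x, `|u x| <= N x.
Proof.
move=> NN su uN x; rewrite ler_norml uN andbT lerNl -NN.
by have := uN (- x); rewrite -scaleN1r scalar_scale// mulN1r.
Qed.

Lemma real_extend_scalars (R : realType) (X : normedModType R) :
  let V := restrict_scalars (idfun : {rmorphism R -> R}) X in
  forall u : V -> R, scalar u -> (forall x, u x <= `|x : X|) ->
  exists f : dual X, forall x, u x = sval f x.
Proof.
move=> V u su uN.
pose f : {linear X -> R^o} := HB.pack (u : X -> R^o)
  (GRing.isLinear.Build R X R^o *:%R (u : X -> R^o) su).
have cf : continuous f.
  apply: (@linear_bound_continuous _ _ f 1) => x; rewrite mul1r.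
  exact: (sublinear_bound (N := fun x : V => `|x : X|) (@normrN _ X) su uN).
by exists (exist _ f cf).
Qed.

Section complexification.
Local Open Scope complex_scope.
Variable R : realType.

Definition real_embedding : {rmorphism R -> R[i]} :=
  GRing.RMorphism.clone _ _ (real_complex R) _.

Variable X : normedModType R[i].
Local Notation V := (restrict_scalars real_embedding X).

(** A real functional u is the real part of the complex functional
x |-> u(x) - i u(i x). *)
Lemma complex_extend_scalars (u : V -> R) : scalar u ->
  (forall x, u x <= complex.Re `|x : X|) ->
  exists f : dual X, forall x, u x = complex.Re (sval f x).
Proof.
move=> su uN.
pose g (x : X) : R[i]^o := (u x +i* - u ('i *: x)).
have uZ (k : R[i]) (x : X) :
    u (k *: x) = complex.Re k * u x + complex.Im k * u ('i *: x).
  have -> : k *: x = (complex.Re k)%:C *: x + (complex.Im k)%:C *: ('i *: x).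
    by rewrite scalerA -scalerDl [k in LHS]complexE mulrC.
  rewrite -(scalar_scale _ (x : V) su) -(scalar_scale _ ('i *: x : V) su).
  by rewrite -(scalar_add _ _ su).
have uD (x y : X) : u (x + y) = u x + u y.
  exact: (scalar_add (x : V) (y : V) su).
have ui (x : X) : u ('i *: ('i *: x)) = - u x.
  by rewrite scalerA -expr2 sqr_i uZ /= oppr0 mulN1r mul0r addr0.
have g_linear : linear g.
  move=> k x y; rewrite /g.
  have -> : 'i *: (k *: x + y) = k *: ('i *: x) + 'i *: y.
    by rewrite scalerDr !scalerA mulrC.
  rewrite !uD !(uZ k) ui.
  case: k => a b; apply/eqP; rewrite eq_complex /=.
  by apply/andP; split; apply/eqP; ring.
pose f : {linear X -> R[i]^o} := HB.pack g
  (GRing.isLinear.Build R[i] X R[i]^o *:%R g g_linear).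
have ub := sublinear_bound (N := fun x : V => complex.Re `|x : X|) _ su uN.
have cf : continuous f.
  apply: (@linear_bound_continuous _ _ f 2) => x.
  have uC (y : X) : `|(u y)%:C| <= `|y|.
    rewrite normc_def /= expr0n addr0 sqrtr_sqr.
    rewrite -[leRHS](@RRe_real _ `|y|) ?normr_real// lecR.
    by apply: ub => z; rewrite normrN.
  have -> : f x = (u x)%:C + 'i * (- u ('i *: x))%:C by rewrite [LHS]complexE.
  apply: le_trans (ler_normD _ _) _.
  have i1 : `|'i : R[i]| = 1.
    by rewrite normc_def /= expr0n expr1n add0r sqrtr1.
  rewrite normrM i1 mul1r rmorphN normrN mulr_natl mulr2n lerD//.
  by apply: le_trans (uC _) _; rewrite normrZ i1 mul1r.
by exists (exist _ f cf).
Qed.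

Lemma Re_continuous : continuous (@complex.Re R : R[i]^o -> R).
Proof.
move=> x; apply/(@cvgrPdist_lt _ _ _ (nbhs (x : R[i]^o))) => d d0.
have d0' : 0 < d%:C by rewrite ltcR.
apply/(@nbhs_normP _ R[i]^o); exists d%:C => //= y xy; rewrite -ltcR.
apply: le_lt_trans xy.
by apply: le_trans (normc_ge_Re (x - y)); case: x y => [a b] [c e].
Qed.

End complexification.

Local Open Scope complex_scope.

(* Real Banach spaces, then complex ones. *)
Theorem theorem2p4 (R : realType) :
  (forall X : completeNormedModType R,
    (rotund_norm X ->
       exists rho : weak X -> weak X -> R,
         is_metric rho /\ fragmented rho) /\
    (wLUR_norm X ->
       exists rho : weak X -> weak X -> R,
         [/\ is_metric rho, fragmented rho &
             forall U : set X, open U -> metric_open rho U])) /\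
  (forall X : completeNormedModType R[i],
    (rotund_norm X ->
       exists rho : weak X -> weak X -> R,
         is_metric rho /\ fragmented rho) /\
    (wLUR_norm X ->
       exists rho : weak X -> weak X -> R,
         [/\ is_metric rho, fragmented rho &
             forall U : set X, open U -> metric_open rho U])).
Proof.
split=> X.
  apply: (@weak_fragmentation R R idfun idfun) => //.
    by move=> x.
  exact: real_extend_scalars.
apply: (@weak_fragmentation R R[i] (real_embedding R) (@complex.Re R)).
- by move=> k k0; rewrite /= RRe_real// ger0_real.
- by move=> x y /=; rewrite lecR.
- exact: Re_continuous.
- exact: complex_extend_scalars.
Qed.
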